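(* Let $k_1,k_2\ge 0$ be integers, $c_1=4k_1+3$, $c_2=4k_2+3$, and $m=c_1c_2-1$. Then every positive integer $p$ satisfying $p\equiv -c_1\pmod m$ or $p\equiv -c_2\pmod m$ is of the form $4k+1$ and admits positive integers $x,y,z$ with $$\frac{4}{p}=\frac{1}{x}+\frac{1}{y}+\frac{1}{z}.$$ *)

(* Defs.v *)
From HB Require Import structures.
From mathcomp Require Import all_boot all_order all_algebra.

Set Implicit Arguments.
Unset Strict Implicit.
Unset Printing Implicit Defensive.

(* Main.v *)
(** Write [m = 4 M] and [p = j m - c1] with [j > 0], and put [t = j c2 - 1].
    Then [c1 t = p + j], so [4/p - 1/(j M) = c1/(p j M) = (p + j)/(t p j M)],
    which gives [4/p = 1/(j M) + 1/(t j M) + 1/(t p M)]. *)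
Require Import Defs.
From mathcomp Require Import all_boot all_order all_algebra.
From mathcomp Require Import zify ring.

Import Order.TTheory GRing.Theory Num.Theory.
Local Open Scope ring_scope.

(** Dividing the last hypothesis by [p * t * j * M] turns [p * t], [p] and [j] into the three unit
    fractions, in this order. *)
Lemma four_div_split (F : fieldType) (p j M t : F) :
  p != 0 -> j != 0 -> M != 0 -> t != 0 -> 4 * (t * j * M) = p * t + p + j ->
  4 / p = 1 / (j * M) + 1 / (t * j * M) + 1 / (t * p * M).
Proof.
move=> p0 j0 M0 t0 e.
have -> : 4 / p = 4 * (t * j * M) / (p * (t * j * M)).
  by field; rewrite p0 j0 M0 t0.
by rewrite e; field; rewrite p0 j0 M0 t0.
Qed.

Lemma erdos_straus_congr (k1 k2 p : int) :
  0 <= k1 -> 0 <= k2 -> 0 < p ->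
  (p = - (4 * k1 + 3) %[mod (4 * k1 + 3) * (4 * k2 + 3) - 1])%Z ->
  (exists k : int, p = 4 * k + 1) /\
  (exists x y z : int, [/\ 0 < x, 0 < y, 0 < z &
     4 / p%:~R = 1 / x%:~R + 1 / y%:~R + 1 / z%:~R :> rat]).
Proof.
move=> k1_ge0 k2_ge0 p_gt0 /eqP; rewrite eqz_mod_dvd => /dvdzP[j].
pose M : int := 4 * k1 * k2 + 3 * k1 + 3 * k2 + 2.
have -> : (4 * k1 + 3) * (4 * k2 + 3) - 1 = 4 * M by rewrite /M; ring.
rewrite opprK => ej.
have M_gt0 : 0 < M by rewrite /M; nia.
(* [j * (4 * M) = p + c1] is positive. *)
have j_gt0 : 0 < j by nia.
pose t := j * (4 * k2 + 3) - 1.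
have t_gt0 : 0 < t by rewrite /t; nia.
have pE : p = 4 * (j * M) - (4 * k1 + 3) by lia.
split; first by exists (j * M - k1 - 1); rewrite pE; ring.
(* As [4 * (j * M) = p + c1], the left side is [p * t + c1 * t]; and [c1 * c2 = 4 * M + 1] gives
   [c1 * t = p + j]. *)
have e : 4 * (t * j * M) = p * t + p + j by rewrite pE /t /M; ring.
exists (j * M), (t * j * M), (t * p * M); split; rewrite ?mulr_gt0 //.
rewrite !intrM; apply: four_div_split; rewrite ?intr_eq0 ?gt_eqF //.
by have := congr1 (intr : int -> rat) e; rewrite !(intrD, intrM).
Qed.

Theorem theorem2p5 (k1 k2 c1 c2 m : int)
  (hk1 : 0 <= k1) (hk2 : 0 <= k2)
  (hc1 : c1 = 4 * k1 + 3) (hc2 : c2 = 4 * k2 + 3)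
  (hm : m = c1 * c2 - 1)
  (p : int) (hp : 0 < p)
  (hcong : (p = - c1 %[mod m])%Z \/ (p = - c2 %[mod m])%Z) :
  (exists k : int, p = 4 * k + 1) /\
  (exists x y z : int, [/\ 0 < x, 0 < y, 0 < z &
     4 / p%:~R = 1 / x%:~R + 1 / y%:~R + 1 / z%:~R :> rat]).
Proof.
subst c1 c2 m; case: hcong => [|h]; first exact: erdos_straus_congr.
(* The modulus is symmetric in [k1] and [k2], so exchanging them reduces this case to the first. *)
by apply: (erdos_straus_congr k2 k1); rewrite // mulrC.
Qed.
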